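(* Let $(r_U,r_W,a,b)$ and $(r_U',r_W',a',b')$ be 4-tuples parameterizing $H$-orbits $\mathcal O(r_U,r_W,a,b)$ and $\mathcal O(r_U',r_W',a',b')$ of isotropic subspaces of $V$ (of possibly different dimensions), where $(G,H)=(\mathrm O_n(\overline{\mathbb F}),\mathrm O_m(\overline{\mathbb F})\times\mathrm O_{n-m}(\overline{\mathbb F}))$. The inclusion order $\mathcal O(r_U,r_W,a,b)\succeq\mathcal O(r_U',r_W',a',b')$ holds if and only if $$r_U\ge r_U',\quad r_W\ge r_W',\quad b\ge b',$$ $$2r_U+2a+b\ge 2r_U'+2a'+b',\qquad 2r_W+2a+b\ge 2r_W'+2a'+b'.$$
   Context: $\overline{\mathbb F}$ is an algebraically closed field of characteristic $\neq2$, $V\simeq\overline{\mathbb F}^n$ has a nondegenerate symmetric bilinear form $B$, $V=U\oplus W$ with $U\perp W$, $\dim U=m$, $\dim W=n-m$, $0<m<n$. $G=\mathrm O_n(\overline{\mathbb F})$ is the isometry group of $V$ and $H=G(U)\times G(W)\simeq\mathrm O_m(\overline{\mathbb F})\times\mathrm O_{n-m}(\overline{\mathbb F})$ is the product of the isometry groups of $U$ and $W$. A subspace $S$ is isotropic if $S\perp S$. For a subspace $X$, $\mathrm{Rad}(X)=X\cap X^\perp$; $\mathbf P_US=(S+W)\cap U$, $\mathbf P_WS=(S+U)\cap W$. For isotropic $S$: $r_U(S)=\dim(S\cap U)$, $r_W(S)=\dim(S\cap W)$, $a(S)=\dim\frac{\mathrm{Rad}(\mathbf P_US)}{S\cap U}=\dim\frac{\mathrm{Rad}(\mathbf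 P_WS)}{S\cap W}$, $b(S)=\dim\frac{\mathbf P_US}{\mathrm{Rad}(\mathbf P_US)}$. The 4-tuple $(r_U(S),r_W(S),a(S),b(S))$ determines the $H$-orbit of $S$ (and has sum $\dim S$); $\mathcal O(r_U,r_W,a,b)$ denotes the $H$-orbit with this 4-tuple. Inclusion order: for $H$-orbits $\mathcal O,\mathcal O'$ of isotropic subspaces, $\mathcal O\succeq\mathcal O'$ means there exist $S\in\mathcal O$ and $S'\in\mathcal O'$ with $S\supseteq S'$. *)

(* Defs.v *)
From mathcomp Require Import all_boot all_order all_algebra.

Set Implicit Arguments.
Unset Strict Implicit.
Unset Printing Implicit Defensive.

Import GRing.Theory.
Local Open Scope ring_scope.

Section IsotropicOrbits.

Variables (F : fieldType) (vT : vectType F) (B : {symmetric vT}).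
Implicit Types (U W S X Y : {vspace vT}) (h : 'End(vT)).

Definition isotropic S : bool := (S <= orthov B S)%VS.

Definition Rad X : {vspace vT} := (X :&: orthov B X)%VS.

(* The image of S under the projection onto U along W when vT = U (+) W;
   the projection onto W is [projs W U S]. *)
Definition projs U W S : {vspace vT} := ((S + W) :&: U)%VS.

(* Dimension of the quotient X / Y; only used for Y <= X, so that the
   truncated subtraction is exact. *)
Definition dim_quot X Y : nat := (\dim X - \dim Y)%N.

Definition r_inv U S : nat := \dim (S :&: U).

(* For isotropic S, S :&: U is contained in Rad (projs U W S): the form vanishes
   between S :&: U and both S and W.  Exchanging U and W gives the same value. *)
Definition a_inv U W S : nat := dim_quot (Rad (projs U W S)) (S :&: U)%VS.

Definition b_inv U W S : nat := dim_quot (projs U W S) (Rad (projs U W S)).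

(* h restricts to an element of the isometry group G(X): in finite dimension
   [h @: X = X] makes the restriction bijective. *)
Definition restricts_to_isometry X h : Prop :=
  (h @: X)%VS = X /\ {in X &, forall u v, B (h u) (h v) = B u v}.

(* When vT = U (+) W, a pair of isometries of U and W is the same thing as an
   endomorphism of vT restricting to an isometry of each. *)
Definition in_H U W h : Prop :=
  restricts_to_isometry U h /\ restricts_to_isometry W h.

Definition H_orbit U W S : {vspace vT} -> Prop :=
  fun S' => exists2 h, in_H U W h & S' = (h @: S)%VS.

(* O is an H-orbit of isotropic subspaces with 4-tuple (rU, rW, a, b). *)
Definition is_orbit_of_type U W (rU rW a b : nat) (O : {vspace vT} -> Prop) :=
  exists S,
    [/\ isotropic S,
        [/\ r_inv U S = rU, r_inv W S = rW, a_inv U W S = a & b_inv U W S = b]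
      & forall S', O S' <-> H_orbit U W S S'].

Definition incl_order (O O' : {vspace vT} -> Prop) : Prop :=
  exists S S', [/\ O S, O' S' & (S' <= S)%VS].

End IsotropicOrbits.

(* Main.v *)
(** Write X = P_U S.  Since S is isotropic, B(P_U s, P_U t) = - B(P_W s, P_W t)
    on S, so the 4-tuple records the dimensions of S, of its subspaces S & U and
    S & W, and of the radical of this common form.  The inequalities are
    necessary because the dimension, the rank, and 2 dim - rank of a subspace
    all increase under inclusion (the last two applied to P_U S and P_W S).

    Conversely S has a basis xs, zs, ds, es, with xs in U and zs in W, whose
    components in U and in W consist of independent isotropic vectors (xs or
    zs, and ds) orthogonal to everything, and of an orthogonal family es of
    constant norm 1 in U and -1 in W.  By a Witt argument any two such bases of
    the same shape are conjugate under H.  Deleting a basis vector, replacing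
    x, z by x + z, or replacing e1, e2 by the isotropic vector e1 + i e2 gives
    hyperplanes of S, and such steps lead to every 4-tuple allowed by the
    inequalities. *)
Require Import Defs.
From mathcomp Require Import all_boot all_order all_algebra.
From HB Require Import structures.
From mathcomp Require Import ring zify.

Set Implicit Arguments.
Unset Strict Implicit.
Unset Printing Implicit Defensive.

Import GRing.Theory.
Local Open Scope ring_scope.

(** * Orthogonal subspaces, and how rank and 2 dim - rank grow under inclusion *)

Section SymmetricForms.

Variables (F : fieldType) (vT : vectType F) (B : {symmetric vT}).
Implicit Types (U V X Y : {vspace vT}) (u v x y : vT) (h : 'End(vT)).

Lemma symfC u v : B u v = B v u.
Proof. by rewrite hermC expr0 mul1r. Qed.

Lemma symf0l v : B 0 v = 0. Proof. exact: linear0l. Qed.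
Lemma symfDl u v y : B (u + v) y = B u y + B v y. Proof. exact: linearDl. Qed.
Lemma symfDr u v y : B y (u + v) = B y u + B y v. Proof. exact: linearDr. Qed.
Lemma symfNl u y : B (- u) y = - B u y. Proof. exact: linearNl. Qed.
Lemma symfNr u y : B y (- u) = - B y u. Proof. exact: linearNr. Qed.
Lemma symfBl u v y : B (u - v) y = B u y - B v y. Proof. exact: linearBl. Qed.
Lemma symfBr u v y : B y (u - v) = B y u - B y v. Proof. exact: linearBr. Qed.
Lemma symfZl c u y : B (c *: u) y = c * B u y. Proof. exact: linearZl_LR. Qed.
Lemma symfZr c u y : B y (c *: u) = c * B y u. Proof. by rewrite symfC symfZl symfC. Qed.

Definition symfE :=
  (symfDl, symfDr, symfBl, symfBr, symfNl, symfNr, symfZl, symfZr).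

Lemma form_orthov X u v : u \in X -> v \in orthov B X -> B u v = 0.
Proof. by move=> uX /mem_orthovP vX; rewrite symfC vX. Qed.

Lemma orthovS X Y : (X <= Y)%VS -> (orthov B Y <= orthov B X)%VS.
Proof.
move=> /subvP sXY; apply/subvP => u /mem_orthovP uY.
by apply/mem_orthovP => v /sXY; apply: uY.
Qed.

(** Each vector of a basis of [X] imposes one linear condition on [Y]; the induction splits one line
    off [X] at a time. *)
Lemma dim_cap_orthov X Y : (\dim Y <= \dim (Y :&: orthov B X) + \dim X)%N.
Proof.
elim: {X}(\dim X) {-2}X (erefl (\dim X)) => [|d IHd] X dimX.
  move/eqP: dimX; rewrite dimv_eq0 => /eqP->.
  by rewrite orthov0 capvf leq_addr.
have /subvPn[x xX x0] : ~~ (X <= 0)%VS by rewrite subv0 -dimv_eq0 dimX.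
pose X1 := (X :\: <[x]>)%VS.
have sX : (<[x]> <= X)%VS by [].
have defX : (X = <[x]> + X1)%VS.
  by rewrite addvC -[LHS](addv_diff_cap X <[x]>%VS) (capv_idPr sX).
have dimX1 : \dim X1 = d.
  have := dimv_cap_compl X <[x]>; rewrite -/X1 (capv_idPr sX) dim_vline dimX.
  by move: x0; rewrite memv0 => ->; rewrite /X1 /=; lia.
have := IHd X1 dimX1.
have := leq_dim_orthov1 B x (Y :&: orthov B X1).
have -> : (Y :&: orthov B X1 :&: orthov B <[x]> = Y :&: orthov B X)%VS.
  apply/vspaceP => v; rewrite -capvA !memv_cap; congr (_ && _).
  rewrite !memvE orthov_sym [(_ <= orthov B <[x]>)%VS]orthov_sym.
  by rewrite [RHS]orthov_sym defX orthoDv andbC.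
by lia.
Qed.

(* Here [dim X + dim Rad X] is [2 * dim X - rank X]. *)
Lemma dim_add_Rad_mono X Y : (X <= Y)%VS ->
  (\dim X + \dim (Rad B X) <= \dim Y + \dim (Rad B Y))%N.
Proof.
(* Orthogonality to a complement of [X] in [Y] cuts [Rad B X] down by at most the dimension of that
   complement, and what remains lies in [Rad B Y]. *)
move=> sXY; have := dim_cap_orthov (Y :\: X)%VS (Rad B X).
have := dimv_cap_compl Y X; rewrite (capv_idPr sXY).
suff : (\dim (Rad B X :&: orthov B (Y :\: X)) <= \dim (Rad B Y))%N by lia.
apply/dimvS/subvP => u; rewrite !memv_cap -andbA => /and3P[uX uX' uYX].
rewrite (subvP sXY) //=; apply/mem_orthovP => v.
rewrite -(addv_diff_cap Y X) (capv_idPr sXY) => /memv_addP[v1 v1P [v2 v2P ->]].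
by rewrite symfDr (mem_orthovP uYX) // (mem_orthovP uX') // addr0.
Qed.

(** Since [X :&: Rad B Y] lies in [Rad B X], the image of [X] in the quotient of [Y] by [Rad B Y]
    has dimension at least the rank of [X]. *)
Lemma dim_sub_Rad_mono X Y : (X <= Y)%VS ->
  (\dim X - \dim (Rad B X) <= \dim Y - \dim (Rad B Y))%N.
Proof.
move=> sXY; have := dimv_sum_cap X (Rad B Y).
have : (\dim (X + Rad B Y) <= \dim Y)%N.
  by apply: dimvS; rewrite subv_add sXY capvSl.
have : (\dim (X :&: Rad B Y) <= \dim (Rad B X))%N.
  apply: dimvS; rewrite /Rad capvA subv_cap (subv_trans (capvSl _ _)) ?capvSl //=.
  by rewrite (subv_trans (capvSr _ _)) ?orthovS.
have : (\dim (Rad B Y) <= \dim Y)%N by rewrite dimvS ?capvSl.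
by lia.
Qed.

(** * Reflections and Witt transport of anisotropic families *)

Definition form_preserving h := forall u v, B (h u) (h v) = B u v.

(* Satisfied by all products of reflections in vectors of [X]. *)
Definition isometry_along X h :=
  [/\ form_preserving h, forall v, h v - v \in X
    & forall v, v \in orthov B X -> h v = v].

Lemma isometry_along_id X : isometry_along X \1%VF.
Proof.
split=> [u v|v|v _]; rewrite ?id_lfunE //.
by rewrite subrr mem0v.
Qed.

Lemma isometry_along_comp X g h :
  isometry_along X g -> isometry_along X h -> isometry_along X (g \o h)%VF.
Proof.
move=> [gB gX g1] [hB hX h1]; split=> [u v|v|v vX]; rewrite !comp_lfunE /=.
- by rewrite gB hB.
- by rewrite -(subrK (h v) (g _)) -addrA memvD.
- by rewrite h1 // g1.
Qed.

Lemma isometry_alongS X Y h :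
  (X <= Y)%VS -> isometry_along X h -> isometry_along Y h.
Proof.
move=> sXY [hB hX h1]; split=> // [v|v vY]; first exact: (subvP sXY).
by apply: h1; apply: (subvP (orthovS sXY)).
Qed.

Lemma isometry_along_mem X h v : isometry_along X h -> (h v \in X) = (v \in X).
Proof. by move=> [_ hX _]; rewrite -(rpredDl v (hX v)) subrK. Qed.

Definition hyperplane_reflection (z v : vT) : vT := v - (2%:R * B v z / B z z) *: z.

Fact hyperplane_reflection_is_linear z : linear (hyperplane_reflection z).
Proof.
move=> c u v; rewrite /hyperplane_reflection scalerBr scalerA addrACA -opprD -scalerDl.
by congr (_ - _ *: _); rewrite !symfE; ring.
Qed.
HB.instance Definition _ z := GRing.isSemilinear.Build F vT vT _ (hyperplane_reflection z)
  (GRing.semilinear_linear (hyperplane_reflection_is_linear z)).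

Lemma isometry_along_reflection X z :
  z \in X -> B z z != 0 -> isometry_along X (linfun (hyperplane_reflection z)).
Proof.
move=> zX z0; split=> [u v|v|v vX]; rewrite ?lfunE /= /hyperplane_reflection.
- by rewrite !symfE (symfC z v); field.
- by rewrite addrC addKr memvN memvZ.
- by rewrite (mem_orthovP vX) // mulr0 mul0r scale0r subr0.
Qed.

Hypothesis two_neq0 : 2%:R != 0 :> F.

(* One of [u - v], [u + v] is anisotropic: reflect in it, and then, in the second
   case, in [v]. *)
Lemma isometry_along_transitive X u v : u \in X -> v \in X ->
  B u u = B v v -> B v v != 0 -> exists2 h, isometry_along X h & h u = v.
Proof.
move=> uX vX uv v0; have uB : B (u - v) (u - v) = 2%:R * (B v v - B u v).
  by rewrite !symfE uv (symfC v u); ring.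
case: (eqVneq (B (u - v) (u - v)) 0) => [uv0|uv_n0].
  have {uv0} Buv : B u v = B v v.
    by move/eqP: uv0; rewrite uB mulf_eq0 (negPf two_neq0) subr_eq0 => /eqP.
  have uDE : B (u + v) (u + v) = 2%:R * 2%:R * B v v.
    by rewrite !symfE uv (symfC v u) Buv; ring.
  have uD_n0 : B (u + v) (u + v) != 0 by rewrite uDE !mulf_neq0.
  exists (linfun (hyperplane_reflection v) \o linfun (hyperplane_reflection (u + v)))%VF.
    by apply: isometry_along_comp; apply: isometry_along_reflection; rewrite ?memvD.
  rewrite comp_lfunE !lfunE /= {2}/hyperplane_reflection symfDr uv Buv uDE.
  have -> : 2%:R * (B v v + B v v) / (2%:R * 2%:R * B v v) = 1.
    by rewrite -[RHS](divff (mulf_neq0 (mulf_neq0 two_neq0 two_neq0) v0)); congr (_ / _); ring.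
  rewrite scale1r opprD addrA subrr add0r /hyperplane_reflection symfNl.
  have -> : 2%:R * - B v v / B v v = - 2%:R by field.
  by rewrite scaleNr opprK scaler_nat mulr2n addKr.
exists (linfun (hyperplane_reflection (u - v))).
  by apply: isometry_along_reflection => //; rewrite memvB.
rewrite lfunE /= /hyperplane_reflection.
have -> : 2%:R * B u (u - v) / B (u - v) (u - v) = 1.
  have : B v v - B u v != 0 by apply: contraNneq uv_n0 => E; rewrite uB E mulr0.
  by move=> n0; rewrite uB symfBr uv; field; rewrite ?n0.
by rewrite scale1r opprB addrCA subrr addr0.
Qed.

Definition orthoscaled (eps : F) (es : seq vT) :=
  all (fun u => B u u == eps) es && pairwise (fun u v => B u v == 0) es.

Lemma orthoscaled_cons eps e es : orthoscaled eps (e :: es) =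
  [&& B e e == eps, all (fun v => B e v == 0) es & orthoscaled eps es].
Proof. by rewrite /orthoscaled /= -!andbA; do !bool_congr. Qed.

Lemma orthoscaled_map eps h es :
  form_preserving h -> orthoscaled eps (map h es) = orthoscaled eps es.
Proof.
move=> hB; rewrite /orthoscaled all_map pairwise_map; congr (_ && _).
  by apply: eq_all => u /=; rewrite hB.
by apply: eq_pairwise => u v /=; rewrite hB.
Qed.

(** Once the first vector has been carried to [e'], the others are treated inside the orthogonal of
    [e'] in [X]. An isometry along that subspace fixes [e'], so the induction does not undo the
    first step. *)
Lemma orthoscaled_transport (eps : F) X (es es' : seq vT) : eps != 0 ->
    {subset es <= X} -> {subset es' <= X} ->
    orthoscaled eps es -> orthoscaled eps es' -> size es = size es' ->
  exists2 h, isometry_along X h & map h es = es'.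
Proof.
move=> eps0; elim: es' es X => [|e' es' IHes] [|e es] X //.
  by exists \1%VF; first exact: isometry_along_id.
move=> esX esX'; rewrite !orthoscaled_cons.
move=> /and3P[/eqP ee e_es oes] /and3P[/eqP ee' e_es' oes'] [size_es].
have [] := @isometry_along_transitive X e e'; rewrite ?ee ?ee' //.
- by rewrite esX ?mem_head.
- by rewrite esX' ?mem_head.
move=> g gX ge; have [gB _ _] := gX.
pose Y := (X :&: orthov B <[e']>)%VS.
have [||||h hY hes] := IHes (map g es) Y _ _ _ oes'; rewrite ?orthoscaled_map ?size_map //.
- move=> _ /mapP[u ues ->]; rewrite memv_cap (isometry_along_mem _ gX).
  rewrite esX ?inE ?ues ?orbT //= mem_orthov1 -ge gB symfC.
  exact: (allP e_es).
- move=> u ues; rewrite memv_cap esX' ?inE ?ues ?orbT //= mem_orthov1 symfC.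
  exact: (allP e_es').
have he' : h e' = e'.
  case: hY => _ _; apply; apply/mem_orthovP => v; rewrite memv_cap mem_orthov1.
  by rewrite symfC => /andP[_ /eqP].
exists (h \o g)%VF; first exact: isometry_along_comp (isometry_alongS (capvSl _ _) hY) gX.
rewrite /= comp_lfunE ge he' -hes -map_comp; congr cons.
by apply: eq_map => u /=; rewrite comp_lfunE.
Qed.

(** * Witt transport in the presence of isotropic vectors *)

(** A vector of [Z] orthogonal to a complement [C] of [X :&: orthov B Z] in [X] is orthogonal to all
    of [X], hence zero by nondegeneracy. So [C] imposes enough conditions to kill [Z], and
    [\dim Z <= \dim C]. *)
Lemma dim_add_cap_orthov X Z : (X :&: orthov B X = 0)%VS -> (Z <= X)%VS ->
  (\dim Z + \dim (X :&: orthov B Z) <= \dim X)%N.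
Proof.
move=> X0 sZX; pose C := (X :\: (X :&: orthov B Z))%VS.
have := dimv_cap_compl X (X :&: orthov B Z); rewrite -/C (capv_idPr (capvSl _ _)).
suff : (\dim Z <= \dim C)%N by lia.
suff Z0 : (Z :&: orthov B C = 0)%VS by have := dim_cap_orthov C Z; rewrite Z0 dimv0.
apply/eqP; rewrite -subv0 -X0 subv_cap (subv_trans (capvSl _ _)) //=.
apply/subvP => z /memv_capP[zZ zC]; apply/mem_orthovP => v.
rewrite -(addv_diff_cap X (X :&: orthov B Z)) => /memv_addP[v1 v1C [v2]].
rewrite !memv_cap => /and3P[_ _ v2Z] ->.
by rewrite symfDr (mem_orthovP zC) // (form_orthov zZ v2Z) addr0.
Qed.

(** Gram-Schmidt: [y'] is obtained by subtracting from [y] its components along [es], one vector at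
    a time. *)
Lemma orthoscaled_project (eps : F) es y : eps != 0 -> orthoscaled eps es ->
  exists2 y', y - y' \in <<es>>%VS & {in es, forall e, B y' e = 0}.
Proof.
move=> eps0; elim: es => [_|e es IHes].
  by exists y => //; rewrite subrr mem0v.
rewrite orthoscaled_cons => /and3P[/eqP ee /allP e_es /IHes[y' yy' y'es]].
exists (y' - (B y' e / eps) *: e).
  rewrite span_cons opprB addrCA.
  by rewrite memv_add ?memvZ ?memv_line.
move=> u; rewrite inE => /predU1P[->|ues]; rewrite !symfE.
  by rewrite ee divfK // subrr.
by rewrite y'es // (eqP (e_es u ues)) mulr0 subrr.
Qed.

(* [xs] is isotropic and orthogonal to the anisotropic family [es]; the norm
   [eps] is a parameter because [es] has norm 1 in U but -1 in W. *)
Definition adapted (eps : F) X xs es :=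
  [/\ free xs, {subset xs ++ es <= X},
      {in xs & xs ++ es, forall x y, B x y = 0} & orthoscaled eps es].

(* An isotropic vector is [p + i q] with [p], [q] orthogonal of equal norm, so
   isotropic vectors can be traded for anisotropic ones. *)
Lemma adapted_split (i eps : F) X x xs es : i * i = -1 -> eps != 0 ->
    (X :&: orthov B X = 0)%VS -> adapted eps X (x :: xs) es ->
  exists p q, x = p + i *: q /\ adapted eps X xs [:: p, q & es].
Proof.
move=> ii eps0 X0 [free_x sX oX oes].
have sxX : (<<x :: xs>> <= X)%VS.
  by apply/span_subvP => u ux; apply: sX; rewrite mem_cat ux.
have xX : x \in X by rewrite sX ?mem_head.
have xx : B x x = 0 by rewrite oX ?mem_head.
have x_xs u : u \in xs -> B x u = 0.
  by move=> uxs; rewrite oX ?inE ?mem_cat ?uxs ?orbT ?eqxx.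
have es_x e : e \in es -> {in x :: xs, forall u, B u e = 0}.
  by move=> ees u uxs; rewrite oX // mem_cat ees orbT.
(* In the nondegenerate [X], adding [x] to the free family [xs] strictly shrinks the orthogonal, so
   some [y0] is orthogonal to [xs] but not to [x]. *)
have /subvPn[y0] : ~~ (X :&: orthov B <<xs>> <= X :&: orthov B <<x :: xs>>)%VS.
  have fxs : free xs by move: free_x; rewrite free_cons => /andP[].
  apply/negP => /dimvS; have := dim_add_cap_orthov X0 sxX.
  have := dim_cap_orthov <<xs>> X; rewrite (eqP free_x) (eqP fxs) /=.
  by set d := (\dim (_ :&: _)); set d' := (\dim (_ :&: _)); lia.
rewrite !memv_cap => /andP[y0X y0xs]; rewrite y0X /=.
move=> y0x; have xy0 : B x y0 != 0.
  apply: contra y0x => /eqP xy0; apply/mem_orthovP => u.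
  rewrite span_cons => /memv_addP[_ /vlineP[k ->] [v vxs ->]].
  by rewrite symfDr symfZr symfC xy0 mulr0 add0r (mem_orthovP y0xs).
(* Making [y0] orthogonal to [es] keeps its products with [x :: xs], which are orthogonal to
   [es]. *)
have [y1 y01 y1es] := orthoscaled_project y0 eps0 oes.
have perp_es u : u \in x :: xs -> B u y1 = B u y0.
  move=> ux; rewrite -[in RHS](subrK y1 y0) symfDr.
  suff -> : B u (y0 - y1) = 0 by rewrite add0r.
  have /subvP/(_ _ y01) : (<<es>> <= orthov B <[u]>)%VS.
    by apply/span_subvP => e ees; rewrite mem_orthov1 symfC es_x.
  by rewrite mem_orthov1 symfC => /eqP.
have y1X : y1 \in X.
  rewrite -(subKr y0 y1) memvB //.
  have /subvP : (<<es>> <= X)%VS by apply/span_subvP => e ees; rewrite sX ?mem_cat ?ees ?orbT.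
  exact.
(* Rescaling gives [B x y = 1], and the multiple of [x] is chosen to make [y] isotropic: [x] and [y]
   form a hyperbolic pair. *)
pose c := B x y0; pose y := c^-1 *: y1 - (B y1 y1 / (2%:R * c ^+ 2)) *: x.
have c0 : c != 0 := xy0.
have xy1 : B x y1 = c by rewrite perp_es ?mem_head.
have xy : B x y = 1 by rewrite !symfE xx xy1 mulr0 subr0 mulVf.
have yy : B y y = 0.
  by rewrite !symfE xx (symfC y1 x) xy1; field; apply/andP.
have yX : y \in X by rewrite memvB ?memvZ.
have xs_y u : u \in xs -> B u y = 0.
  move=> uxs; rewrite !symfE (symfC u x) x_xs // perp_es ?inE ?uxs ?orbT //.
  by rewrite symfC (mem_orthovP y0xs) ?memv_span // !mulr0 subrr.
have y_es e : e \in es -> B y e = 0.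
  by move=> ees; rewrite /y !symfE y1es // (es_x _ ees x (mem_head x xs)) !mulr0 subrr.
clearbody y.
(* The vectors x/2 + eps y and x/2 - eps y are orthogonal, of norms eps and -eps, and have sum [x];
   the factor [- i] turns the second norm into eps. *)
exists (2%:R^-1 *: x + eps *: y), (- i *: (2%:R^-1 *: x - eps *: y)); split.
  rewrite scalerA mulrN ii opprK scale1r addrACA subrr addr0 -scalerDl.
  by rewrite -mulr2n -[_ *+ 2]mulr_natl divff // scale1r.
split.
- by move: free_x; rewrite free_cons => /andP[].
- move=> u; rewrite mem_cat !inE => /or4P[|/eqP->|/eqP->|].
  + by move=> uxs; rewrite sX // !inE mem_cat uxs orbT.
  + by rewrite memvD ?memvZ.
  + by rewrite memvZ ?memvB ?memvZ.
  + by move=> ues; rewrite sX // !inE mem_cat ues !orbT.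
- move=> u v uxs; rewrite mem_cat !inE => /or4P[|/eqP->|/eqP->|].
  + by move=> vxs; rewrite oX // !inE ?mem_cat ?uxs ?vxs ?orbT.
  + by rewrite !symfE xs_y // symfC x_xs // !mulr0 addr0.
  + by rewrite !symfE xs_y // symfC x_xs // !mulr0 subrr mulr0.
  + by move=> ves; rewrite es_x // inE uxs orbT.
- rewrite !orthoscaled_cons oes andbT /=; apply/and4P; split.
  + by rewrite !symfE xx yy (symfC y x) xy; apply/eqP; field.
  + apply/andP; split; first by rewrite !symfE xx yy (symfC y x) xy; apply/eqP; field.
    by apply/allP => e ees; rewrite !symfE y_es // (es_x _ ees x (mem_head x xs)) !mulr0 addr0.
  + rewrite !symfE xx yy (symfC y x) xy; apply/eqP.
    by rewrite -[RHS]mul1r -[in RHS](opprK 1) -ii; field.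
  + by apply/allP => e ees; rewrite !symfE y_es // (es_x _ ees x (mem_head x xs)) !mulr0 subrr mulr0.
Qed.

(** Each isotropic vector is traded for two anisotropic ones until only anisotropic families remain;
    linearity of [h] on [p + i *: q] then recovers the isotropic vectors. *)
Lemma adapted_transport (i eps : F) X xs es xs' es' : i * i = -1 -> eps != 0 ->
    (X :&: orthov B X = 0)%VS -> adapted eps X xs es -> adapted eps X xs' es' ->
    size xs = size xs' -> size es = size es' ->
  exists2 h, isometry_along X h & map h xs = xs' /\ map h es = es'.
Proof.
move=> ii eps0 X0; elim: xs xs' es es' => [|x xs IHxs] [|x' xs'] es es' //.
  move=> [_ esX _ oes] [_ es'X _ oes'] _ /(orthoscaled_transport eps0 esX es'X oes oes').
  by case=> h hX hes; exists h.
move=> /(adapted_split ii eps0 X0)[p [q [-> A]]].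
move=> /(adapted_split ii eps0 X0)[p' [q' [-> A']]] [sxs] ses.
have [|h hX [hxs [hp hq hes]]] := IHxs _ _ _ A A' sxs; first by rewrite /= ses.
by exists h => //; rewrite /= hxs hes linearD linearZ /= hp hq.
Qed.

End SymmetricForms.

(** * Projections attached to an orthogonal decomposition *)

Section OrthogonalDecomposition.

Variables (F : fieldType) (vT : vectType F) (B : {symmetric vT}).
Implicit Types (U W S T X : {vspace vT}) (u v x y : vT) (h : 'End(vT)).

Definition orthogonal_decomposition U W :=
  [/\ (U + W = fullv)%VS, (U :&: W = 0)%VS, (U <= orthov B W)%VS & nondegenerate B].

Lemma orthogonal_decompositionC U W :
  orthogonal_decomposition U W -> orthogonal_decomposition W U.
Proof. by case=> VUW UW0 UW nd; split; rewrite // 1?addvC 1?capvC // orthov_sym. Qed.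

Variables (U W : {vspace vT}).
Hypothesis UW : orthogonal_decomposition U W.
Let pU := daddv_pi U W.
Let pW := daddv_pi W U.

Lemma daddv_piD v : pU v + pW v = v.
Proof. by case: UW => VUW UW0 _ _; rewrite daddv_pi_add // VUW memvf. Qed.

Lemma daddv_pi_eq0 v : (pU v == 0) = (v \in W).
Proof.
apply/eqP/idP => [v0|vW]; first by rewrite -(daddv_piD v) v0 add0r memv_pi.
apply: (addIr (pW v)); rewrite daddv_piD add0r daddv_pi_id // capvC.
by case: UW.
Qed.

Lemma daddv_pi_mem u : u \in U -> pU u = u.
Proof. by move=> uU; rewrite /pU daddv_pi_id //; case: UW. Qed.

Lemma form_across u v : u \in U -> v \in W -> B u v = 0.
Proof. by case: UW => _ _ /orthovP UperpW _; apply: UperpW. Qed.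

Lemma form_decomp u v : B u v = B (pU u) (pU v) + B (pW u) (pW v).
Proof.
rewrite -{1}(daddv_piD u) -{1}(daddv_piD v) !symfE.
rewrite [B (pU u) (pW v)]form_across ?memv_pi // [B (pW u) (pU v)]symfC.
by rewrite [B (pU v) (pW u)]form_across ?memv_pi // addr0 add0r.
Qed.

Lemma form_daddv_pi u v : B u (pU v) = B (pU u) (pU v).
Proof. by rewrite -{1}(daddv_piD u) symfDl [B (pW u) _]symfC [B _ (pW u)]form_across ?memv_pi ?addr0. Qed.

Lemma orthogonal_decomposition_nondeg : (U :&: orthov B U = 0)%VS.
Proof.
apply/eqP; rewrite -subv0; apply/subvP => u /memv_capP[uU u_perp].
have /eqP <- : nondegenerate B by case: UW.
apply/mem_orthovP => v _; rewrite -(daddv_piD v) symfDr [B u (pW v)]form_across ?memv_pi //.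
by rewrite (mem_orthovP u_perp) ?memv_pi // addr0.
Qed.

Lemma sub_orthov_decomp : (W <= orthov B U)%VS.
Proof. by rewrite orthov_sym; case: UW. Qed.

Lemma projsE S : projs U W S = (pU @: S)%VS.
Proof.
apply/vspaceP => x; rewrite memv_cap; apply/andP/memv_imgP.
  move=> [/memv_addP[s sS [w wW ->]]] swU; exists s => //.
  rewrite -[LHS]daddv_pi_mem //.
  by rewrite linearD /=; move: wW; rewrite -daddv_pi_eq0 => /eqP->; rewrite addr0.
move=> [s sS ->]; split; last exact: memv_pi.
by rewrite -[pU s](addrK (pW s)) daddv_piD memv_add // memvN memv_pi.
Qed.

Lemma cap_lker_daddv_pi S : (S :&: lker pU = S :&: W)%VS.
Proof. by apply/vspaceP => v; rewrite !memv_cap memv_ker daddv_pi_eq0. Qed.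

Lemma dim_projs S : (\dim (projs U W S) + \dim (S :&: W) = \dim S)%N.
Proof. by rewrite projsE addnC -cap_lker_daddv_pi limg_ker_dim. Qed.

(** The right-hand subspace is the radical of the form B(P_U s, P_U t) on [S]. It maps onto the
    radical of P_U S with kernel [S :&: W]. *)
Lemma dim_Rad_projs S :
  (\dim (Rad B (projs U W S)) + \dim (S :&: W) = \dim (S :&: orthov B (projs U W S)))%N.
Proof.
have sWR : (W <= orthov B (projs U W S))%VS.
  by apply: subv_trans sub_orthov_decomp _; apply: orthovS; apply: capvSr.
rewrite -[RHS](limg_ker_dim pU) cap_lker_daddv_pi -capvA (capv_idPr sWR) addnC.
suff -> : Rad B (projs U W S) = (pU @: (S :&: orthov B (projs U W S)))%VS by [].
apply/vspaceP => x; rewrite projsE memv_cap; apply/andP/memv_imgP.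
  move=> [/memv_imgP[s sS ->] ps]; exists s => //; rewrite memv_cap sS.
  apply/mem_orthovP => _ /memv_imgP[t tS ->].
  by rewrite form_daddv_pi (mem_orthovP ps) ?memv_img.
move=> [s /memv_capP[sS ps] ->]; split; first exact: memv_img.
apply/mem_orthovP => _ /memv_imgP[t tS ->].
by rewrite -form_daddv_pi (mem_orthovP ps) ?memv_img.
Qed.

Lemma isotropicP S : reflect {in S &, forall u v, B u v = 0} (isotropic B S).
Proof. exact: orthovP. Qed.

Lemma cap_sub_Rad_projs S : isotropic B S -> (S :&: U <= Rad B (projs U W S))%VS.
Proof.
move=> /isotropicP S0; apply/subvP => u /memv_capP[uS uU]; rewrite memv_cap.
rewrite projsE; apply/andP; split.
  by apply/memv_imgP; exists u; rewrite // -/pU daddv_pi_mem.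
apply/mem_orthovP => _ /memv_imgP[t tS ->].
rewrite -[RHS](S0 u t) // -[in RHS](daddv_piD t) symfDr.
by rewrite [B u (pW t)]form_across ?memv_pi ?addr0.
Qed.

(* The right-hand side is 2 dim - rank of the projection of [S] to [U]. *)
Lemma double_rank_defect S : isotropic B S ->
  (2 * r_inv U S + 2 * a_inv B U W S + b_inv B U W S =
   \dim (projs U W S) + \dim (Rad B (projs U W S)))%N.
Proof.
move=> S0; have /dimvS := cap_sub_Rad_projs S0.
have : (\dim (Rad B (projs U W S)) <= \dim (projs U W S))%N by rewrite dimvS ?capvSl.
rewrite /r_inv /a_inv /b_inv /dim_quot; lia.
Qed.

Lemma projsS S T : (S <= T)%VS -> (projs U W S <= projs U W T)%VS.
Proof. by move=> sST; rewrite !projsE limgS. Qed.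

End OrthogonalDecomposition.

(** * Symmetry, monotonicity and H-invariance of the 4-tuple *)

Section Invariants.

Variables (F : fieldType) (vT : vectType F) (B : {symmetric vT}).
Variables (U W : {vspace vT}).
Implicit Types (S T : {vspace vT}) (u v : vT) (h : 'End(vT)).
Hypothesis UW : orthogonal_decomposition B U W.
Let WU := orthogonal_decompositionC UW.

(** The products of [s] with the two components of [t] add up to [B s t = 0], so one vanishes
    exactly when the other does. *)
Lemma cap_orthov_projsC S : isotropic B S ->
  (S :&: orthov B (projs U W S) = S :&: orthov B (projs W U S))%VS.
Proof.
move=> /isotropicP S0; rewrite (projsE UW) (projsE WU).
have BpUW s t : s \in S -> t \in S -> B s (daddv_pi U W t) = - B s (daddv_pi W U t).
  by move=> sS tS; apply/eqP; rewrite -addr_eq0 -symfDr (daddv_piD UW) S0.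
apply/vspaceP => s; rewrite !memv_cap; case sS: (s \in S) => //=.
apply/mem_orthovP/mem_orthovP => s0 _ /memv_imgP[t tS ->].
  by apply: oppr_inj; rewrite -BpUW // oppr0 s0 // memv_img.
by rewrite BpUW // s0 ?oppr0 ?memv_img.
Qed.

(** If K is the common subspace of [cap_orthov_projsC], both sides equal dim K - dim (S & U) - dim
    (S & W). *)
Lemma a_invC S : isotropic B S -> a_inv B U W S = a_inv B W U S.
Proof.
move=> S0; have := dim_Rad_projs UW S; rewrite cap_orthov_projsC //.
rewrite -(dim_Rad_projs WU) /a_inv /dim_quot.
have /dimvS := cap_sub_Rad_projs UW S0; have /dimvS := cap_sub_Rad_projs WU S0.
lia.
Qed.

(** With the same K, both sides equal dim S - dim K. *)
Lemma b_invC S : isotropic B S -> b_inv B U W S = b_inv B W U S.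
Proof.
move=> S0; have := dim_Rad_projs UW S; rewrite cap_orthov_projsC //.
rewrite -(dim_Rad_projs WU) /b_inv /dim_quot.
have := dim_projs UW S; have := dim_projs WU S.
lia.
Qed.

Lemma invariants_mono S T : isotropic B S -> (T <= S)%VS ->
  [/\ (r_inv U T <= r_inv U S)%N, (r_inv W T <= r_inv W S)%N,
      (b_inv B U W T <= b_inv B U W S)%N,
      (2 * r_inv U T + 2 * a_inv B U W T + b_inv B U W T <=
       2 * r_inv U S + 2 * a_inv B U W S + b_inv B U W S)%N
    & (2 * r_inv W T + 2 * a_inv B U W T + b_inv B U W T <=
       2 * r_inv W S + 2 * a_inv B U W S + b_inv B U W S)%N].
Proof.
move=> S0 sTS; have T0 : isotropic B T.
  by apply/isotropicP => u v /(subvP sTS) uS /(subvP sTS); apply: (isotropicP _ _ S0).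
split; rewrite ?(double_rank_defect UW) ?dim_add_Rad_mono ?(projsS UW) //.
- by rewrite dimvS ?capvS.
- by rewrite dimvS ?capvS.
- exact: dim_sub_Rad_mono (projsS UW sTS).
(* The last inequality is the preceding one for the exchanged decomposition, by the symmetry of
   [a_inv] and [b_inv]. *)
- rewrite !a_invC // !b_invC // !(double_rank_defect WU) //.
  by rewrite dim_add_Rad_mono ?(projsS WU).
Qed.

Lemma in_H_form_preserving h : in_H B U W h -> form_preserving B h.
Proof.
case=> [[hU BU] [hW BW]] u v.
have hpU x : h (daddv_pi U W x) \in U by rewrite -{2}hU memv_img ?memv_pi.
have hpW x : h (daddv_pi W U x) \in W by rewrite -{2}hW memv_img ?memv_pi.
rewrite (form_decomp UW u) -{1}(daddv_piD UW u) -{1}(daddv_piD UW v) !linearD /= !symfE.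
rewrite [B (h (daddv_pi U W u)) (h (daddv_pi W U v))](form_across UW) //.
rewrite [B (h (daddv_pi W U u)) (h (daddv_pi U W v))](form_across WU) //.
by rewrite addr0 add0r BU ?memv_pi // BW ?memv_pi.
Qed.

Lemma form_preserving_lker0 h : form_preserving B h -> lker h == 0%VS.
Proof.
move=> hB; have nd : nondegenerate B by case: UW.
rewrite -subv0 -(eqP nd); apply/subvP => u /[!memv_ker] /eqP hu0.
by apply/mem_orthovP => v _; rewrite -hB hu0 symf0l.
Qed.

Lemma limg_orthov_cap h S T : form_preserving B h ->
  (h @: (S :&: orthov B T) = h @: S :&: orthov B (h @: T))%VS.
Proof.
move=> hB; apply/vspaceP => x; rewrite memv_cap; apply/memv_imgP/andP.
  move=> [s /memv_capP[sS sT] ->]; split; first exact: memv_img.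
  by apply/mem_orthovP => _ /memv_imgP[t tT ->]; rewrite hB (mem_orthovP sT).
move=> [/memv_imgP[s sS ->] hs]; exists s => //; rewrite memv_cap sS.
by apply/mem_orthovP => t tT; rewrite -hB (mem_orthovP hs) ?memv_img.
Qed.

(** An element of H is injective, preserves the form and stabilizes [U] and [W], so it commutes with
    intersections, projections and radicals. Hence the 4-tuple of an orbit can be read on any of its
    members. *)
Lemma invariants_in_H h S : in_H B U W h -> isotropic B S ->
  isotropic B (h @: S) /\
  [/\ r_inv U (h @: S) = r_inv U S, r_inv W (h @: S) = r_inv W S,
      a_inv B U W (h @: S) = a_inv B U W S & b_inv B U W (h @: S) = b_inv B U W S].
Proof.
move=> Hh /isotropicP S0; have hB := in_H_form_preserving Hh.
have h0 := form_preserving_lker0 hB; case: Hh => [[hU _] [hW _]].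
have dimh T : \dim (h @: T) = \dim T.
  by apply: limg_dim_eq; rewrite (eqP h0) capv0.
have capU T : (h @: T :&: U)%VS = (h @: (T :&: U))%VS by rewrite lker0_img_cap // hU.
have capW T : (h @: T :&: W)%VS = (h @: (T :&: W))%VS by rewrite lker0_img_cap // hW.
have hprojs : projs U W (h @: S) = (h @: projs U W S)%VS.
  by rewrite /projs -{1}hW -limgD capU.
split.
  by apply/isotropicP => _ _ /memv_imgP[u uS ->] /memv_imgP[v vS ->]; rewrite hB S0.
by split; rewrite /a_inv /b_inv /r_inv /dim_quot ?hprojs /Rad -?limg_orthov_cap ?capU ?capW ?dimh.
Qed.

End Invariants.

(** * Elementary operations on adapted families *)

Lemma perm_cat_cons (T : eqType) (s t : seq T) (x : T) :
  perm_eq (s ++ x :: t) (x :: s ++ t).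
Proof. by rewrite -(cat1s x t) -(cat1s x (s ++ t)) perm_catCA. Qed.

Section AdaptedFamilies.

Variables (F : fieldType) (vT : vectType F) (B : {symmetric vT}).
Implicit Types (X : {vspace vT}) (xs es : seq vT) (x e : vT).

Lemma adapted_perm (eps : F) X xs xs' es :
  perm_eq xs xs' -> adapted B eps X xs es -> adapted B eps X xs' es.
Proof.
move=> pxs [fxs sX oX oes]; have mxs := perm_mem pxs.
split=> // [|u|u v]; first by rewrite -(perm_free pxs).
  by rewrite mem_cat -mxs -mem_cat => /sX.
by rewrite mem_cat -!mxs -mem_cat; apply: oX.
Qed.

Lemma adapted_behead_l (eps : F) X x xs es :
  adapted B eps X (x :: xs) es -> adapted B eps X xs es.
Proof.
move=> [fxs sX oX oes]; split=> // [|u u_in|u v uxs v_in].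
- by move: fxs; rewrite free_cons => /andP[].
- by rewrite sX // inE u_in orbT.
- by rewrite oX // inE ?uxs ?v_in orbT.
Qed.

Lemma adapted_behead_r (eps : F) X e xs es :
  adapted B eps X xs (e :: es) -> adapted B eps X xs es.
Proof.
have s_es : {subset xs ++ es <= xs ++ e :: es}.
  by move=> u; rewrite !mem_cat inE => /orP[]->; rewrite ?orbT.
move=> [fxs sX oX oes]; split=> // [u /s_es/sX //|u v uxs /s_es|].
  exact: oX.
by move: oes; rewrite orthoscaled_cons => /and3P[].
Qed.

(** The vector [e1 + i *: e2] has norm eps + i^2 eps = 0. It is independent of [xs] because its
    product with [e1] is [eps], while [xs] is orthogonal to [e1]. *)
Lemma adapted_merge (i eps : F) X e1 e2 xs es : i * i = -1 -> eps != 0 ->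
  adapted B eps X xs [:: e1, e2 & es] ->
  adapted B eps X (e1 + i *: e2 :: xs) es.
Proof.
move=> ii eps0 [fxs sX oX].
rewrite !orthoscaled_cons /= => /and3P[/eqP e11 /andP[/eqP e12 /allP e1es]].
move=> /and3P[/eqP e22 /allP e2es oes].
have xs1 u : u \in xs -> B u e1 = 0 by move=> ?; rewrite oX // mem_cat !inE eqxx !orbT.
have xs2 u : u \in xs -> B u e2 = 0 by move=> ?; rewrite oX // mem_cat !inE eqxx !orbT.
pose d := e1 + i *: e2.
have oxs u v : u \in xs -> v \in xs ++ es -> B u v = 0.
  by move=> ? vin; rewrite oX // !mem_cat !inE; move: vin; rewrite mem_cat => /orP[]->; rewrite ?orbT.
have dxs u : u \in xs -> B u d = 0.
  by move=> uxs; rewrite !symfE xs1 // xs2 // mulr0 addr0.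
have dd : B d d = 0.
  by rewrite !symfE (symfC _ e2 e1) e11 e12 e22; ring: ii.
have des u : u \in es -> B d u = 0.
  by move=> ues; rewrite !symfE (eqP (e1es u ues)) (eqP (e2es u ues)) mulr0 addr0.
split=> // [|u|u v].
- rewrite free_cons fxs andbT; apply/negP => d_xs.
  have /subvP/(_ _ d_xs) : (<<xs>> <= orthov B <[e1]>)%VS.
    by apply/span_subvP => u uxs; rewrite mem_orthov1 xs1.
  by rewrite mem_orthov1 !symfE e11 (symfC _ e2) e12 mulr0 addr0 (negPf eps0).
- rewrite inE => /predU1P[->|u_in].
    by rewrite memvD ?memvZ // sX // mem_cat !inE eqxx !orbT.
  by rewrite sX //; move: u_in; rewrite !mem_cat !inE => /orP[]->; rewrite ?orbT.
- rewrite [v \in _]inE inE -/d => /predU1P[->|uxs] /predU1P[->|v_in] //.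
  + move: v_in; rewrite mem_cat => /orP[vxs|ves]; last exact: des.
    by rewrite symfC dxs.
  + exact: dxs.
  + exact: oxs.
Qed.

End AdaptedFamilies.

Lemma free_map_cap0 (F : fieldType) (aT rT : vectType F) (f : 'Hom(aT, rT)) (xs : seq aT) :
  free xs -> (<<xs>> :&: lker f = 0)%VS -> free (map f xs).
Proof.
move=> fxs f0; apply: (@basis_free _ _ (f @: <<xs>>)).
by apply: limg_basis_of => //; rewrite /basis_of eqxx.
Qed.

Lemma lift_seq (F : fieldType) (aT rT : vectType F) (f : 'Hom(aT, rT))
    (S : {vspace aT}) (us : seq rT) : {subset us <= (f @: S)%VS} ->
  exists2 ss, {subset ss <= S} & map f ss = us.
Proof.
elim: us => [|u us IHus] sub_us; first by exists [::].
have [|ss ssS fss] := IHus; first by move=> v v_us; rewrite sub_us // inE v_us orbT.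
have /memv_imgP[s sS us_s] := sub_us u (mem_head u us).
exists (s :: ss); last by rewrite /= fss us_s.
by move=> v; rewrite inE => /predU1P[->|/ssS].
Qed.

Lemma closed_sqrt (F : closedFieldType) (c : F) : exists s, s * s = c.
Proof.
have [s sE] := @solve_monicpoly F 2 (fun k => if k == 0%N then c else 0) isT.
exists s; rewrite -expr2 sE big_ord_recl big_ord1 /=.
by rewrite expr0 mulr1 mul0r addr0.
Qed.

(** * Orthonormal bases over an algebraically closed field *)

Section ClosedField.

Variables (F : closedFieldType) (vT : vectType F) (B : {symmetric vT}).
Hypothesis two_neq0 : 2%:R != 0 :> F.
Implicit Types (S T X U W : {vspace vT}) (u v x : vT).

(** If [x] and [y] are isotropic with [B x y] nonzero, then [x + y] has norm [2 B x y], which is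
    nonzero; an anisotropic vector is normalized by a square root of its norm. *)
Lemma exists_unit_vector X : (X :&: orthov B X = 0)%VS -> X != 0%VS ->
  exists2 e, e \in X & B e e = 1.
Proof.
move=> X0 Xn0; have [v vX v0] : exists2 v, v \in X & B v v != 0.
  have x0 : vpick X != 0 by rewrite vpick0.
  have /mem_orthovPn[y yX xy0] : vpick X \notin orthov B X.
    by apply: contra x0 => xX; rewrite -memv0 -X0 memv_cap memv_pick.
  set x := vpick X in xy0; have xX : x \in X by apply: memv_pick.
  case: (eqVneq (B x x) 0) => [xx|]; last by exists x.
  case: (eqVneq (B y y) 0) => [yy|]; last by exists y.
  exists (x + y); first by rewrite memvD.
  rewrite !symfE (symfC _ y x) xx yy add0r addr0.
  by rewrite -mulr2n -mulr_natl mulf_neq0.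
have [s ss] := closed_sqrt (B v v); exists (s^-1 *: v); first by rewrite memvZ.
rewrite !symfE -ss; field.
by apply: contraNneq v0 => s0; rewrite -ss s0 mulr0.
Qed.

Lemma exists_orthonormal_basis X : (X :&: orthov B X = 0)%VS ->
  exists2 es, basis_of X es & orthoscaled B 1 es.
Proof.
elim: {X}(\dim X) {-2}X (leqnn (\dim X)) => [|d IHd] X dimX X0.
  exists [::] => //; move: dimX; rewrite leqn0 dimv_eq0 => /eqP->.
  exact: nil_basis.
case: (eqVneq X 0%VS) => [->|Xn0]; first by exists [::]; first exact: nil_basis.
have [e eX ee] := exists_unit_vector X0 Xn0.
pose X1 := (X :&: orthov B <[e]>)%VS.
have eX1 : e \notin X1 by rewrite memv_cap mem_orthov1 ee oner_eq0 andbF.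
have defX : X = (<[e]> + X1)%VS.
  apply/eqP; rewrite eqEsubv subv_add -[(<[e]> <= X)%VS]memvE eX capvSl !andbT.
  apply/subvP => v vX; rewrite -(subrK (B v e *: e) v) addrC memv_add ?memvZ ?memv_line //.
  by rewrite memv_cap memvB ?memvZ // mem_orthov1 !symfE ee mulr1 subrr eqxx.
have [||es bes oes] := IHd X1.
- rewrite -ltnS (leq_trans _ dimX) // ltnNge.
  apply: contra eX1 => le; have/eqP -> // : X1 == X by rewrite eqEdim capvSl.
- apply/eqP; rewrite -subv0 -X0; apply/subvP => u /memv_capP[/memv_capP[uX ue] uX1].
  rewrite memv_cap uX; apply/mem_orthovP => v; rewrite defX.
  move=> /memv_addP[_ /vlineP[k ->] [w wX1 ->]].
  by rewrite !symfE (mem_orthovP ue) ?memv_line // (mem_orthovP uX1) // mulr0 addr0.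
exists (e :: es); last first.
  rewrite orthoscaled_cons ee eqxx oes andbT /=; apply/allP => u ues.
  by have := basis_mem bes ues; rewrite memv_cap mem_orthov1 symfC => /andP[].
by rewrite /basis_of span_cons free_cons (span_basis bes) -defX eqxx (basis_free bes) eX1.
Qed.

(** * Existence of adapted bases of isotropic subspaces *)

Definition adapted_basis U W (xs zs ds es : seq vT) S :=
  [/\ <<xs ++ zs ++ ds ++ es>>%VS = S,
      adapted B 1 U (xs ++ map (daddv_pi U W) ds) (map (daddv_pi U W) es)
    & adapted B (- 1) W (zs ++ map (daddv_pi W U) ds) (map (daddv_pi W U) es)].

(** Storing the 4-tuple as list sizes turns the passage to a hyperplane into an operation on
    lists. *)
Definition has_adapted_basis U W (rU rW a b : nat) S :=
  exists xs zs ds es, adapted_basis U W xs zs ds es S /\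
    [/\ size xs = rU, size zs = rW, size ds = a & size es = b].

Variables (U W : {vspace vT}).
Hypothesis UW : orthogonal_decomposition B U W.
Let WU := orthogonal_decompositionC UW.
Let pU := daddv_pi U W.
Let pW := daddv_pi W U.

(** The chain S & U <= Rad (P_U S) <= P_U S is filled up by complements: [xs] is a basis of the
    first term, while [ds] and [es] lift to [S] a basis of the first complement and an orthonormal
    basis of the second. The kernel of P_U on [S] contributes [zs]. *)
Lemma isotropic_adapted_basis S : isotropic B S ->
  has_adapted_basis U W (r_inv U S) (r_inv W S) (a_inv B U W S) (b_inv B U W S) S.
Proof.
move=> S0; pose X := projs U W S; pose R := Rad B X.
pose A := (S :&: U)%VS; pose C := (S :&: W)%VS.
have sAR : (A <= R)%VS := cap_sub_Rad_projs UW S0.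
have sRX : (R <= X)%VS := capvSl _ _.
have XE : X = (pU @: S)%VS := projsE UW S.
(* The form is nondegenerate on a complement of its radical. *)
have [es0 bes0 oes0] : exists2 es, basis_of (X :\: R) es & orthoscaled B 1 es.
  apply: exists_orthonormal_basis; apply/eqP; rewrite -subv0 -(capv_diff X R).
  apply/subvP => u /memv_capP[uXR u_perp]; have uX := subvP (diffvSl _ _) _ uXR.
  rewrite memv_cap uXR memv_cap uX; apply/mem_orthovP => v.
  rewrite -(addv_diff_cap X R) (capv_idPr sRX) => /memv_addP[v1 v1X [v2 v2R ->]].
  rewrite symfDr (mem_orthovP u_perp) // (@form_orthov _ _ _ X) ?addr0 //.
  by move: v2R; rewrite memv_cap => /andP[].
have [es esS pes] : exists2 es, {subset es <= S} & map pU es = es0.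
  by apply: lift_seq => u /(basis_mem bes0) uX; rewrite -XE (subvP (diffvSl _ _) _ uX).
have [ds dsS pds] : exists2 ds, {subset ds <= S} & map pU ds = vbasis (R :\: A).
  apply: lift_seq => u /vbasis_mem uR.
  by rewrite -XE (subvP sRX) // (subvP (diffvSl _ _) _ uR).
pose xs : seq vT := vbasis A; pose zs : seq vT := vbasis C.
have xsA u : u \in xs -> u \in A by apply: vbasis_mem.
have zsC u : u \in zs -> u \in C by apply: vbasis_mem.
have pxs : map pU xs = xs.
  by apply: map_id_in => u /xsA /memv_capP[_ uU]; apply: (daddv_pi_mem UW).
have pzs : map pW zs = zs.
  by apply: map_id_in => u /zsC /memv_capP[_ uW]; apply: (daddv_pi_mem WU).
have dimA := dimvS sAR; have dimR := dimvS sRX.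
have size_ds : size ds = a_inv B U W S.
  have := congr1 size pds; rewrite size_map size_tuple => ->.
  by have := dimv_cap_compl R A; rewrite (capv_idPr sAR) /a_inv /dim_quot -/R -/A; lia.
have size_es : size es = b_inv B U W S.
  have := congr1 size pes; rewrite size_map => ->.
  have := eqP (basis_free bes0); rewrite (span_basis bes0) => <-.
  by have := dimv_cap_compl X R; rewrite (capv_idPr sRX) /b_inv /dim_quot -/R -/X; lia.
have size_xs : size xs = r_inv U S by rewrite size_tuple.
have size_zs : size zs = r_inv W S by rewrite size_tuple.
have sub_S u : u \in xs ++ zs ++ ds ++ es -> u \in S.
  rewrite !mem_cat => /or4P[/xsA|/zsC|/dsS|/esS] //; first by case/memv_capP.
  by case/memv_capP.
(* The vectors [xs], [ds], [es] project onto a spanning family of [X] and [zs] spans the kernel, so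
   the list spans [S]; freeness then follows by counting. *)
have bS : basis_of S (xs ++ zs ++ ds ++ es).
  rewrite basisEdim; apply/andP; split; last first.
    rewrite !size_cat size_xs size_zs size_ds size_es -(dim_projs UW S).
    rewrite /r_inv /a_inv /b_inv /dim_quot -/A -/C -/X -/R; lia.
  apply/subvP => s sS.
  have : pU s \in X by rewrite XE memv_img.
  have -> : X = (pU @: <<xs ++ ds ++ es>>)%VS.
    rewrite limg_span !map_cat pxs pds pes !span_cat.
    rewrite !(span_basis (vbasisP _)) (span_basis bes0) addvA.
    rewrite -{1}(addv_diff_cap X R) (capv_idPr sRX) addvC; congr (_ + _)%VS.
    by rewrite -{1}(addv_diff_cap R A) (capv_idPr sAR) addvC.
  move=> /memv_imgP[t tT pst].
  have tS : t \in S.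
    apply: (subvP _ _ tT); apply/span_subvP => u u_in; apply: sub_S.
    by move: u_in; rewrite !mem_cat => /or3P[]->; rewrite ?orbT.
  have stC : s - t \in C.
    by rewrite memv_cap memvB //= -(daddv_pi_eq0 UW) linearB /= pst subrr.
  have -> : s = t + (s - t) by rewrite addrC subrK.
  have eqi : xs ++ zs ++ ds ++ es =i (xs ++ ds ++ es) ++ zs.
    by move=> u; rewrite !mem_cat -!orbA; do !bool_congr.
  by rewrite (eq_span eqi) span_cat memv_add // (span_basis (vbasisP C)).
have fS := basis_free bS.
(* This sign transfers the orthogonality relations from [U] to [W] and gives [es] norm -1 there. *)
have BpW s t : s \in S -> t \in S -> B (pW s) (pW t) = - B (pU s) (pU t).
  move=> sS tS; apply/eqP; rewrite -addr_eq0 addrC -(form_decomp UW).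
  by apply/eqP; apply: (isotropicP _ _ S0).
have radxd u v : u \in R -> v \in X -> B u v = 0.
  by rewrite memv_cap => /andP[_ uX] vX; rewrite symfC (form_orthov vX).
exists xs, zs, ds, es; do !split=> //.
- exact: span_basis bS.
(* A combination of [xs] and [ds] lying in [W] belongs to the span of [zs], so it vanishes by
   freeness of the whole list. *)
- rewrite -pxs -map_cat; apply: free_map_cap0.
    move: fS; rewrite catA (perm_free (_ : perm_eq _ (zs ++ xs ++ ds ++ es))).
      by move/catr_free; rewrite catA => /catl_free.
    by rewrite -catA perm_catCA.
  apply/eqP; rewrite -subv0; apply/subvP => v.
  rewrite memv_cap memv_ker (daddv_pi_eq0 UW) => /andP[vin vW].
  have vC : v \in C.
    rewrite memv_cap vW andbT; apply: (subvP _ _ vin); apply/span_subvP => u u_in.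
    by apply: sub_S; move: u_in; rewrite !mem_cat => /orP[]->; rewrite ?orbT.
  have : free (zs ++ (xs ++ ds) ++ es).
    by rewrite -(perm_free (_ : perm_eq (xs ++ zs ++ ds ++ es) _)) // -catA perm_catCA.
  rewrite catA => /catl_free; rewrite cat_free => /and3P[_ _].
  rewrite directv_addE => /and3P[_ _ /eqP cap0].
  by rewrite -cap0 memv_cap vin andbT (span_basis (vbasisP C)).
- move=> u; rewrite !mem_cat -!orbA => /or3P[/xsA/memv_capP[]//|/mapP[v _ ->]|/mapP[v _ ->]];
  exact: memv_pi.
- move=> u v uin vin; apply: radxd.
    move: uin; rewrite mem_cat pds => /orP[/xsA/(subvP sAR)//|/vbasis_mem uR].
    exact: (subvP (diffvSl _ _) _ uR).
  move: vin; rewrite -pxs -!map_cat => /mapP[t t_in ->].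
  rewrite XE memv_img // sub_S //.
  by move: t_in; rewrite !mem_cat => /orP[/orP[]|]->; rewrite ?orbT.
- by rewrite pes.
- rewrite -pzs -map_cat; apply: free_map_cap0.
    by move: fS => /catr_free; rewrite catA => /catl_free.
  apply/eqP; rewrite -subv0; apply/subvP => v.
  rewrite memv_cap memv_ker (daddv_pi_eq0 WU) => /andP[vin vU].
  have vA : v \in A.
    rewrite memv_cap vU andbT; apply: (subvP _ _ vin); apply/span_subvP => u u_in.
    by apply: sub_S; move: u_in; rewrite !mem_cat => /orP[]->; rewrite ?orbT.
  move: fS; rewrite [zs ++ _]catA catA => /catl_free; rewrite cat_free => /and3P[_ _].
  rewrite directv_addE => /and3P[_ _ /eqP cap0].
  by rewrite -cap0 memv_cap vin andbT (span_basis (vbasisP A)).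
- move=> u; rewrite !mem_cat -!orbA => /or3P[/zsC/memv_capP[]//|/mapP[v _ ->]|/mapP[v _ ->]];
  exact: memv_pi.
- move=> u v; rewrite -pzs -!map_cat => /mapP[s s_in ->] /mapP[t t_in ->].
  have sS : s \in S by apply: sub_S; move: s_in; rewrite !mem_cat => /orP[]->; rewrite ?orbT.
  have tS : t \in S.
    by apply: sub_S; move: t_in; rewrite !mem_cat => /orP[/orP[]|]->; rewrite ?orbT.
  rewrite BpW // radxd ?oppr0 //; last by rewrite XE memv_img.
  move: s_in; rewrite mem_cat => /orP[/zsC|s_ds].
    by case/memv_capP => _; rewrite -(daddv_pi_eq0 UW) => /eqP ->; rewrite mem0v.
  have : pU s \in map pU ds by apply: map_f.
  by rewrite pds => /vbasis_mem uR; apply: (subvP (diffvSl _ _) _ uR).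
- move: oes0; rewrite -pes /orthoscaled !all_map !pairwise_map => /andP[/allP u1 u2].
  apply/andP; split; first by apply/allP => e ees /=; rewrite BpW ?esS // (eqP (u1 e ees)).
  have esS' : all (mem S) es by apply/allP.
  by apply: sub_in_pairwise esS' u2 => e f ees fes /=; rewrite BpW // oppr_eq0.
Qed.

(** * Conjugacy under H of adapted bases of the same shape *)

Lemma map_daddv_pi f g (ss ss' : seq vT) :
    map f (map pU ss) = map pU ss' -> map g (map pW ss) = map pW ss' ->
  map (fun v => f (pU v) + g (pW v)) ss = ss'.
Proof.
elim: ss ss' => [|s ss IHss] [|s' ss'] //= [fs fss] [gs gss].
by rewrite fs gs (daddv_piD UW) (IHss ss').
Qed.

Lemma isometry_along_fix (X Y : {vspace vT}) h : isometry_along B X h -> (Y <= orthov B X)%VS ->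
  {in Y, forall v, h v = v}.
Proof. by move=> [_ _ hfix] /subvP sYX v /sYX; apply: hfix. Qed.

(** Witt transport is applied in [U] and in [W] separately. Each isometry fixes the other summand
    pointwise, so the composite acts independently on the two components of every basis vector. *)
Lemma adapted_basis_conj rU rW a b S S' :
    has_adapted_basis U W rU rW a b S -> has_adapted_basis U W rU rW a b S' ->
  H_orbit B U W S S'.
Proof.
move=> [xs [zs [ds [es [[<- AU AW] [sx sz sd se]]]]]].
move=> [xs' [zs' [ds' [es' [[<- AU' AW'] [sx' sz' sd' se']]]]]].
have [i ii] := closed_sqrt (- 1 : F).
have [||hU hUX [hUx hUe]] := adapted_transport two_neq0 ii (oner_neq0 _)
  (orthogonal_decomposition_nondeg UW) AU AU'.
- by rewrite !size_cat !size_map sx sd sx' sd'.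
- by rewrite !size_map se se'.
have N1 : -1 != 0 :> F by rewrite oppr_eq0 oner_eq0.
have [||hW hWX [hWz hWe]] := adapted_transport two_neq0 ii N1
  (orthogonal_decomposition_nondeg WU) AW AW'.
- by rewrite !size_cat !size_map sz sd sz' sd'.
- by rewrite !size_map se se'.
move/eqP: hUx; rewrite map_cat eqseq_cat ?size_map ?sx // => /andP[/eqP hUx /eqP hUd].
move/eqP: hWz; rewrite map_cat eqseq_cat ?size_map ?sz // => /andP[/eqP hWz /eqP hWd].
have hU1 := isometry_along_fix hUX (sub_orthov_decomp UW).
have hW1 := isometry_along_fix hWX (sub_orthov_decomp WU).
pose h := (hU \o hW)%VF.
have hU_U u : u \in U -> h u = hU u by move=> uU; rewrite comp_lfunE /= hW1.
have hW_W w : w \in W -> h w = hW w.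
  by move=> wW; rewrite comp_lfunE /= hU1 // (isometry_along_mem _ hWX).
have hB : form_preserving B h.
  by case: hUX hWX => [BU _ _] [BW _ _] u v; rewrite !comp_lfunE /= BU BW.
have h0 := form_preserving_lker0 UW hB.
have hE v : h v = hU (pU v) + hW (pW v).
  by rewrite -{1}(daddv_piD UW v) linearD /= hU_U ?hW_W ?memv_pi.
exists h.
  split; split; try by move=> u v _ _; apply: hB.
    apply/eqP; rewrite eqEdim limg_dim_eq ?(eqP h0) ?capv0 // leqnn andbT.
    by apply/subvP => _ /memv_imgP[u uU ->]; rewrite hU_U // (isometry_along_mem _ hUX).
  apply/eqP; rewrite eqEdim limg_dim_eq ?(eqP h0) ?capv0 // leqnn andbT.
  by apply/subvP => _ /memv_imgP[u uW ->]; rewrite hW_W // (isometry_along_mem _ hWX).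
rewrite limg_span !map_cat (eq_map hE ds) (eq_map hE es).
rewrite (map_daddv_pi hUd hWd) (map_daddv_pi hUe hWe).
have -> : map h xs = xs'.
  rewrite -hUx; apply/eq_in_map => x xxs; apply: hU_U.
  by case: AU => _ sU _ _; apply: sU; rewrite !mem_cat xxs.
suff -> : map h zs = zs' by [].
rewrite -hWz; apply/eq_in_map => z zzs; apply: hW_W.
by case: AW => _ sW _ _; apply: sW; rewrite !mem_cat zzs.
Qed.

(** * Passing to hyperplanes, and descent to every admissible 4-tuple *)

Lemma adapted_basis_dropU rU rW a b S : has_adapted_basis U W rU.+1 rW a b S ->
  exists2 T, (T <= S)%VS & has_adapted_basis U W rU rW a b T.
Proof.
move=> [[|x xs] [zs [ds [es [[<- AU AW] [//= [sx] sz sd se]]]]]].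
exists <<xs ++ zs ++ ds ++ es>>%VS; first by rewrite span_cons addvSr.
exists xs, zs, ds, es; split=> //; split=> //.
exact: adapted_behead_l AU.
Qed.

Lemma adapted_basis_dropW rU rW a b S : has_adapted_basis U W rU rW.+1 a b S ->
  exists2 T, (T <= S)%VS & has_adapted_basis U W rU rW a b T.
Proof.
move=> [xs [[|z zs] [ds [es [[<- AU AW] [//= sx [sz] sd se]]]]]].
exists <<xs ++ zs ++ ds ++ es>>%VS.
  by apply: sub_span => u; rewrite !(mem_cat, inE) => /orP[]->; rewrite ?orbT.
exists xs, zs, ds, es; split=> //; split=> //.
exact: adapted_behead_l AW.
Qed.

Lemma adapted_basis_dropD rU rW a b S : has_adapted_basis U W rU rW a.+1 b S ->
  exists2 T, (T <= S)%VS & has_adapted_basis U W rU rW a b T.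
Proof.
move=> [xs [zs [[|d ds] [es [[<- AU AW] [//= sx sz [sd] se]]]]]].
exists <<xs ++ zs ++ ds ++ es>>%VS.
  by apply: sub_span => u; rewrite !(mem_cat, inE) => /or3P[||]->; rewrite ?orbT.
exists xs, zs, ds, es; split=> //; split=> //.
  apply: (@adapted_behead_l _ _ _ _ _ (pU d)); exact: adapted_perm (perm_cat_cons _ _ _) AU.
apply: (@adapted_behead_l _ _ _ _ _ (pW d)); exact: adapted_perm (perm_cat_cons _ _ _) AW.
Qed.

Lemma adapted_basis_dropE rU rW a b S : has_adapted_basis U W rU rW a b.+1 S ->
  exists2 T, (T <= S)%VS & has_adapted_basis U W rU rW a b T.
Proof.
move=> [xs [zs [ds [[|e es] [[<- AU AW] [//= sx sz sd [se]]]]]]].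
exists <<xs ++ zs ++ ds ++ es>>%VS.
  by apply: sub_span => u; rewrite !(mem_cat, inE) => /or4P[]->; rewrite ?orbT.
exists xs, zs, ds, es; split=> //; split=> //.
  exact: adapted_behead_r AU.
exact: adapted_behead_r AW.
Qed.

(** The components of [x + z] are [x] and [z], so the isotropic families in [U] and [W] are merely
    permuted. *)
Lemma adapted_basis_glueUW rU rW a b S : has_adapted_basis U W rU.+1 rW.+1 a b S ->
  exists2 T, (T <= S)%VS & has_adapted_basis U W rU rW a.+1 b T.
Proof.
move=> [[|x xs] [[|z zs] [ds [es [[<- AU AW] [//= [sx] [sz] sd se]]]]]].
have xU : x \in U by case: AU => _ sU _ _; apply: sU; rewrite mem_head.
have zW : z \in W by case: AW => _ sW _ _; apply: sW; rewrite mem_head.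
have px : pU (x + z) = x.
  apply/eqP; rewrite linearD /= (daddv_pi_mem UW) //.
  by rewrite -subr_eq0 addrAC subrr add0r (daddv_pi_eq0 UW).
have pz : pW (x + z) = z.
  apply/eqP; rewrite linearD /= [pW z](daddv_pi_mem WU) //.
  by rewrite -subr_eq0 addrK (daddv_pi_eq0 WU).
exists <<xs ++ zs ++ ((x + z)%R :: ds) ++ es>>%VS.
  apply/span_subvP => u; rewrite !(mem_cat, inE) -!orbA.
  case/or4P => [uin|uin|/eqP->|/orP[] uin].
  all: try by rewrite memv_span // !(mem_cat, inE) uin ?orbT.
  by apply: memvD; apply: memv_span; rewrite !(mem_cat, inE) eqxx ?orbT.
exists xs, zs, (x + z :: ds), es; split; last by rewrite /= sd.
split=> //=; rewrite -/pU -/pW ?px ?pz.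
  by apply: adapted_perm AU; rewrite perm_sym perm_cat_cons.
by apply: adapted_perm AW; rewrite perm_sym perm_cat_cons.
Qed.

(** The same [i] serves on both sides: [adapted_merge] applies with norm 1 in [U] and norm -1 in
    [W]. *)
Lemma adapted_basis_glueE rU rW a b S : has_adapted_basis U W rU rW a b.+2 S ->
  exists2 T, (T <= S)%VS & has_adapted_basis U W rU rW a.+1 b T.
Proof.
have [i ii] := closed_sqrt (- 1 : F).
have N1 : -1 != 0 :> F by rewrite oppr_eq0 oner_eq0.
move=> [xs [zs [ds [[|e1 [|e2 es]] [[<- AU AW] [//= sx sz sd [se]]]]]]].
exists <<xs ++ zs ++ ((e1 + i *: e2)%R :: ds) ++ es>>%VS.
  apply/span_subvP => u; rewrite !(mem_cat, inE) -!orbA.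
  case/or4P => [uin|uin|/eqP->|/orP[] uin].
  all: try by rewrite memv_span // !(mem_cat, inE) uin ?orbT.
  by apply: memvD; rewrite ?memvZ //; apply: memv_span; rewrite !(mem_cat, inE) eqxx ?orbT.
exists xs, zs, (e1 + i *: e2 :: ds), es; split; last by rewrite /= sd.
split=> //=; rewrite linearD linearZ /=.
  have := adapted_merge ii (oner_neq0 _) AU.
  by apply: adapted_perm; rewrite perm_sym perm_cat_cons.
have := adapted_merge ii N1 AW.
by apply: adapted_perm; rewrite perm_sym perm_cat_cons.
Qed.

(** Induction on the sum of the 4-tuple: as long as it differs from the target, some hyperplane of
    [S] has a 4-tuple that still satisfies the inequalities. *)
Lemma adapted_basis_sub rU rW a b rU' rW' a' b' S :
    has_adapted_basis U W rU rW a b S ->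
    [/\ (rU >= rU')%N, (rW >= rW')%N, (b >= b')%N,
        (2 * rU + 2 * a + b >= 2 * rU' + 2 * a' + b')%N
      & (2 * rW + 2 * a + b >= 2 * rW' + 2 * a' + b')%N] ->
  exists2 T, (T <= S)%VS & has_adapted_basis U W rU' rW' a' b' T.
Proof.
clear two_neq0; move: {2}(rU + rW + a + b)%N (erefl (rU + rW + a + b)%N) => k.
elim: k rU rW a b S => [|k IHk] rU rW a b S.
  move=> sz St [? ? ? ? ?]; exists S => //.
  have [-> -> -> ->] : [/\ rU' = rU, rW' = rW, a' = a & b' = b] by split; lia.
  by [].
move=> sz St ineqs.
have step rU1 rW1 a1 b1 :
    (exists2 T, (T <= S)%VS & has_adapted_basis U W rU1 rW1 a1 b1 T) ->
    (rU1 + rW1 + a1 + b1 = k)%N ->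
    [/\ (rU1 >= rU')%N, (rW1 >= rW')%N, (b1 >= b')%N,
        (2 * rU1 + 2 * a1 + b1 >= 2 * rU' + 2 * a' + b')%N
      & (2 * rW1 + 2 * a1 + b1 >= 2 * rW' + 2 * a' + b')%N] ->
  exists2 T, (T <= S)%VS & has_adapted_basis U W rU' rW' a' b' T.
  move=> [T sTS Tt] szT ineqsT; have [T' sT'T T't] := IHk _ _ _ _ T szT Tt ineqsT.
  by exists T' => //; apply: subv_trans sTS.
case: ineqs => leU leW leb leP leQ.
(* Gluing is tried first, since it leaves both 2 r + 2 a + b unchanged; only the bounds on [b], [rU]
   and [rW] have to be watched. *)
have [bb'|bb'] := leqP b'.+2 b.
  case: b => [|[|b]] in sz St leb leP leQ bb' *; try lia.
  by apply: step (adapted_basis_glueE St) _ _; [lia | split; lia].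
have [/andP[ltU ltW]|nlt] := boolP ((rU' < rU)%N && (rW' < rW)%N).
  case: rU => [|rU] in sz St leU leP ltU *; first by lia.
  case: rW => [|rW] in sz St leW leQ ltW *; first by lia.
  by apply: step (adapted_basis_glueUW St) _ _; [lia | split; lia].
(* Here [b] is [b'] or [b'.+1]. In the second case parity makes the last two inequalities strict, so
   a vector of [es] can be deleted. *)
have [eb|nb] := eqVneq b b'; last first.
  case: b => [|b] in sz St leb leP leQ bb' nb *; first by lia.
  by apply: step (adapted_basis_dropE St) _ _; [lia | split; lia].
(* Now [b = b'], and [rU] or [rW] has reached its target; the corresponding weighted inequality
   yields [a' <= a], so deleting vectors is safe. *)
have [ltU|geU] := ltnP rU' rU.
  case: rU => [|rU] in sz St leU leP ltU nlt *; first by lia.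
  by apply: step (adapted_basis_dropU St) _ _; [lia | split; lia].
have [ltW|geW] := ltnP rW' rW.
  case: rW => [|rW] in sz St leW leQ ltW nlt *; first by lia.
  by apply: step (adapted_basis_dropW St) _ _; [lia | split; lia].
have [lta|gea] := ltnP a' a.
  case: a => [|a] in sz St leP leQ lta *; first by lia.
  by apply: step (adapted_basis_dropD St) _ _; [lia | split; lia].
exists S => //.
have [-> -> -> ->] : [/\ rU' = rU, rW' = rW, a' = a & b' = b] by split; lia.
by [].
Qed.

End ClosedField.

(** * The numerical criterion for the inclusion order *)

Theorem theorem4p6 (F : closedFieldType) (charF : 2%N \notin [pchar F])
    (n m : nat) (m_gt0 : (0 < m)%N) (m_ltn : (m < n)%N)
    (vT : vectType F) (dimV : \dim {:vT} = n)
    (B : {symmetric vT}) (ndB : nondegenerate B)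
    (U W : {vspace vT})
    (VUW : (U + W)%VS = {:vT}%VS) (UW0 : (U :&: W)%VS = 0%VS)
    (UperpW : (U <= orthov B W)%VS)
    (dimU : \dim U = m) (dimW : \dim W = (n - m)%N)
    (rU rW a b rU' rW' a' b' : nat) (O O' : {vspace vT} -> Prop)
    (O_orbit : is_orbit_of_type B U W rU rW a b O)
    (O'_orbit : is_orbit_of_type B U W rU' rW' a' b' O') :
  incl_order O O' <->
  [/\ (rU >= rU')%N, (rW >= rW')%N, (b >= b')%N,
      (2 * rU + 2 * a + b >= 2 * rU' + 2 * a' + b')%N
    & (2 * rW + 2 * a + b >= 2 * rW' + 2 * a' + b')%N].
Proof.
have UW : orthogonal_decomposition B U W by split.
have two_neq0 : 2%:R != 0 :> F by move: charF; rewrite inE.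
case: O_orbit => S [S0 [<- <- <- <-] OE]; case: O'_orbit => S' [S'0 [<- <- <- <-] O'E].
split.
  case=> T [T' [/OE[h Hh ->] /O'E[h' Hh' ->] sT'T]].
  have [hS0 [<- <- <- <-]] := invariants_in_H UW Hh S0.
  have [_ [<- <- <- <-]] := invariants_in_H UW Hh' S'0.
  exact: invariants_mono.
move=> ineqs.
(* The representative [S] contains a subspace [T] with an adapted basis of the shape of [S'];
   conjugacy places [T] in the orbit of [S']. *)
have [T sTS Tt] := adapted_basis_sub UW (isotropic_adapted_basis two_neq0 UW S0) ineqs.
exists S, T; split=> //.
  apply/OE; exists \1%VF; last by rewrite lim1g.
  by split; split; rewrite ?lim1g // => u v _ _; rewrite !id_lfunE.
by apply/O'E; apply: adapted_basis_conj Tt => //; apply: isotropic_adapted_basis.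
Qed.
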